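(* In the stochastic control setting described in the context, let $\Omega(0)=\{\varphi\in S_{ad}: I(\varphi)\le 0\}$, $J_o=\inf_{\varphi\in\Omega(0)}J(\varphi)$, and $d(\Omega(0),\varphi)=\inf_{\psi\in\Omega(0)}\|\psi-\varphi\|$. If there exist numbers $L_I,L_J>0$ such that $$|J(\varphi)-J(\varphi_1)|\le L_J\|\varphi_1-\varphi\|\quad\text{for all }\varphi,\varphi_1\in S_{ad},$$ $$I(\varphi)\ge L_I\, d(\Omega(0),\varphi)\quad\text{for all }\varphi\in S_{ad},$$ then there exists a number $q>0$ such that $$J_o-J(\varphi)\le q\,I(\varphi)\quad\text{for all }\varphi\in S_{ad}.$$
   Context: System. Let $N\ge 1$ be the control horizon and consider the stochastic system $x_{k+1}=f(x_k,u_k,w_k)$, $y_k=h(x_k,v_k)$, $k=0,1,\dots$, with $x_k\in\mathbb{R}^n$, $y_k\in\mathbb{R}^m$, $w_k\in\mathbb{R}^{n_w}$, $v_k\in\mathbb{R}^{n_v}$, $u_k\in U_{ad}=\{u\in\mathbb{R}^r: u_{\min}\le u\le u_{\max}\}$ (elementwise inequalities; in some justified cases $U_{ad}=\mathbb{R}^r$ is also allowed). The functions $f,h$ are $C^2$ in all arguments; $w_k$ has density $p_w$, $v_k$ has density $p_v$, $x_0$ has density $p_0^-$, and $x_0,w_0,\dots,w_k,v_0,\dots,v_k$ are mutually independent for all $k$. Write $Y_k=\mathrm{col}(y_0,\dots,y_k)$, $X=\mathrm{col}(x_0,\dots,x_{N-1})$, $Y=\mathrm{col}(y_0,\dots,y_{N-1})$,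 $U=\mathrm{col}(u_0,\dots,u_{N-1})$. Strategies. An admissible strategy is a map $\varphi:\mathbb{R}^{mN}\to U_{ad}^N\subset\mathbb{R}^{Nr}$ of the form $\varphi(Y)=\mathrm{col}(\varphi_0(Y_0),\dots,\varphi_{N-1}(Y_{N-1}))$ with each $\varphi_k:\mathbb{R}^{m(k+1)}\to U_{ad}$ measurable; the control is $u_k=\varphi_k(Y_k)$, so $U=\varphi(Y)$. The set of all admissible strategies is $S_{ad}$; it is regarded as a subset of the Banach space of bounded maps $\mathbb{R}^{Nm}\to\mathbb{R}^{Nr}$ with norm $\|g\|=\sup_{Y}\|g(Y)\|_{\mathbb{R}^{Nr}}$. Cost. $L:\mathbb{R}^n\to\mathbb{R}$ is a measurable $C^2$ function and $J(\varphi)=E\{L(x_N)\mid\varphi\}$, the expectation being over $x_0,w_0,\dots,w_{N-1},v_0,\dots,v_{N-1}$ with strategy $\varphi$ applied. It is assumed that $J$ attains its minimum over $S_{ad}$. Information. $I(\varphi)=H(X|\varphi)-H(X|U,\varphi)$ is the mutual information between $X$ and $U$ under the strategy $\varphi$, where $H(X|\varphi)=E(-\ln p(X|\varphi))$ and $H(X|U,\varphi)=E(-\ln p(X|U,\varphi))$ (expectation over $X$ and $U$). Constant strategies have $I(\varphi)=0$, so $\Omega(0)$ is non-empty. $J_o$ is called the minimum open-loop cost. For every $s\ge0$ it is assumed that the infimum of $J$ over $\{\varphi\in S_{ad}: I(\varphi)\le s\}$ is attained. *)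

(* Defs.v *)
From HB Require Import structures.
From mathcomp Require Import all_boot all_order all_algebra.
From mathcomp Require Import all_classical all_reals all_analysis.
Import Order.TTheory GRing.Theory Num.Theory.
Import numFieldNormedType.Exports.

Set Implicit Arguments.
Unset Strict Implicit.
Unset Printing Implicit Defensive.

Local Open Scope classical_set_scope.
Local Open Scope ring_scope.

(** The library has no measurable structure on matrices: as for tuples, take
    the sigma-algebra generated by the entries (the Borel one on R^(m * n)). *)

Definition measure_matrix_display : measure_display -> measure_display.
Proof. exact. Qed.

Section measurable_matrix.
Variables (R : realType) (m n : nat).

Definition mx_coord (k : 'I_(m * n)) (M : 'M[R]_(m, n)) : R :=
  mxvec M 0 k.

Let mx_set0 : g_sigma_preimage mx_coord set0.
Proof. exact: sigma_algebra0. Qed.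

Let mx_setC A : g_sigma_preimage mx_coord A -> g_sigma_preimage mx_coord (~` A).
Proof. exact: sigma_algebraC. Qed.

Let mx_bigcup (F : _^nat) : (forall i, g_sigma_preimage mx_coord (F i)) ->
  g_sigma_preimage mx_coord (\bigcup_i (F i)).
Proof. exact: sigma_algebra_bigcup. Qed.

HB.instance Definition _ := @isMeasurable.Build
  (measure_matrix_display default_measure_display)
  'M[R]_(m, n) (g_sigma_preimage mx_coord) mx_set0 mx_setC mx_bigcup.

End measurable_matrix.

(** Lebesgue measure on R^n, as the n-fold product of [lebesgue_measure],
    and its transport to matrices. *)

Lemma product_sigma_finite d d' (T1 : measurableType d) (T2 : measurableType d')
    (R : realType) (m1 : {sigma_finite_measure set T1 -> \bar R})
    (m2 : {sigma_finite_measure set T2 -> \bar R}) :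
  sigma_finite setT (m1 \x m2)%E.
Proof.
have /sigma_finiteP[F [TF ndF Foo]] := sigma_finiteT m1.
have /sigma_finiteP[G [TG ndG Goo]] := sigma_finiteT m2.
exists (fun n => F n `*` G n).
  rewrite -setXTT TF TG predeqE => -[x y]; split.
    move=> [/= [n _ Fnx] [k _ Gky]]; exists (maxn n k) => //; split.
    - by move: x Fnx; exact/subsetPset/ndF/leq_maxl.
    - by move: y Gky; exact/subsetPset/ndG/leq_maxr.
  by move=> [n _ []/= ? ?]; split; exists n.
move=> k; have [? ?] := Foo k; have [? ?] := Goo k.
split; first exact: measurableX.
by rewrite product_measure1E// lte_mul_pinfty// ge0_fin_numE.
Qed.

Lemma pushforward_sigma_finite d d' (T1 : measurableType d)
    (T2 : measurableType d') (R : realType)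
    (mu : {measure set T1 -> \bar R}) (f : T1 -> T2) (g : T2 -> T1) :
  sigma_finite setT mu -> measurable_fun setT g -> cancel f g -> sigma_finite setT (pushforward mu f).
Proof.
move=> [F TF Foo] mg fK.
exists (fun i => g @^-1` F i); first by rewrite -preimage_bigcup -TF preimage_setT.
move=> i; have [mF Fi] := Foo i; split.
  by rewrite -[X in measurable X]setTI; exact: mg.
rewrite /pushforward -comp_preimage.
by rewrite (_ : g \o f = id)//; apply/funext => z /=; rewrite fK.
Qed.

Section prod_cons.
Context d (T : measurableType d) (R : realType) (n : nat).
Variables (m1 : {sigma_finite_measure set T -> \bar R})
          (m2 : {sigma_finite_measure set (n.-tuple T) -> \bar R}).

Definition tuple_consp (z : T * n.-tuple T) : n.+1.-tuple T :=
  [the n.+1.-tuple T of z.1 :: z.2].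

Let tuple_unconsp (t : n.+1.-tuple T) : T * n.-tuple T :=
  (thead t, [tuple of behead t]).

Let measurable_tuple_consp : measurable_fun setT tuple_consp.
Proof. exact: measurable_cons. Qed.

Let measurable_tuple_unconsp : measurable_fun setT tuple_unconsp.
Proof.
by apply/measurable_fun_pair; [exact: measurable_tnth|exact: measurable_behead].
Qed.

Let tuple_conspK : cancel tuple_consp tuple_unconsp.
Proof.
by case=> a t; rewrite /tuple_unconsp/= theadE; congr pair; exact: val_inj.
Qed.

Definition measure_cons : set (n.+1.-tuple T) -> \bar R :=
  pushforward (m1 \x m2)%E tuple_consp.

HB.instance Definition _ := Measure.copy measure_cons
  (measure_function_pushforward__canonical__measure_function_Measure
     (m1 \x m2)%E measurable_tuple_consp).

Let measure_cons_sigma_finite : sigma_finite setT measure_cons.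
Proof.
exact: (pushforward_sigma_finite (product_sigma_finite m1 m2)
         measurable_tuple_unconsp tuple_conspK).
Qed.

HB.instance Definition _ := Measure_isSigmaFinite.Build _ _ _ measure_cons
  measure_cons_sigma_finite.

End prod_cons.

Section lebesgue_vector.
Variable R : realType.
Notation RR := (measurableTypeR R).

Fixpoint lebesgue_tuple n : {sigma_finite_measure set (n.-tuple RR) -> \bar R} :=
  if n is k.+1 then measure_cons lebesgue_measure (lebesgue_tuple k)
  else \d_([tuple] : 0.-tuple RR).

Lemma lebesgue_tuple_box n (A : 'I_n -> set RR) :
  (forall i, measurable (A i)) ->
  lebesgue_tuple n [set t | forall i, A i (tnth t i)] =
  (\prod_(i < n) lebesgue_measure (A i))%E.
Proof.
elim: n A => [|n IH] A mA.
  rewrite big_ord0 /= /dirac indicE mem_set//=.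
  by move=> -[].
rewrite big_ord_recl /= /measure_cons /pushforward.
rewrite -IH// -product_measure1E//; last first.
  rewrite (_ : [set t | _] = \bigcap_(i : 'I_n) ((@tnth n RR)^~ i @^-1` A (lift ord0 i))).
    by apply: fin_bigcap_measurable => // i _; rewrite -[X in measurable X]setTI; exact: measurable_tnth.
  by apply/seteqP; split => t /= At i *; exact: At.
congr (_ _ _ _); apply/seteqP; split => -[a t] /=.
  by move=> At; split => [|i]; [exact: (At ord0)|have := At (lift ord0 i); rewrite tnthS].
move=> [Aa At] i; case: (unliftP ord0 i) => [j|] ->; first by rewrite tnthS; exact: At.
by [].
Qed.

Variables m n : nat.

Definition mx_of_tuple (t : (m * n).-tuple RR) : 'M[R]_(m, n) :=
  vec_mx (\row_k tnth t k).

Let measurable_mx_of_tuple : measurable_fun setT mx_of_tuple.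
Proof.
move=> _ Y mY; rewrite setTI.
suff : g_sigma_preimage (fun k => mx_coord k \o mx_of_tuple) (mx_of_tuple @^-1` Y).
  rewrite (_ : (fun k => _) = (fun k t => tnth t k))//.
  apply/funext => k; apply/funext => t /=.
  by rewrite /mx_coord /mx_of_tuple vec_mxK mxE.
by rewrite g_sigma_preimage_comp; exists Y => //; rewrite setTI.
Qed.

Definition lebesgue_mx : set 'M[R]_(m, n) -> \bar R :=
  pushforward (lebesgue_tuple (m * n)) mx_of_tuple.

HB.instance Definition _ := Measure.copy lebesgue_mx
  (measure_function_pushforward__canonical__measure_function_Measure
     (lebesgue_tuple (m * n)) measurable_mx_of_tuple).

End lebesgue_vector.

(** [Ck k f]: all iterated directional derivatives of [f] up to order [k] exist
    and are continuous; on finite-dimensional spaces this is C^k. *)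
Fixpoint Ck (R : realType) (V W : normedModType R) (k : nat) (f : V -> W) : Prop :=
  continuous f /\
  if k is k'.+1 then
    forall v : V, (forall x, derivable f x v) /\ Ck k' (fun x => 'D_v f x)
  else True.

Section densities.
Context d (T : measurableType d) (R : realType).

Definition is_density (mu : {measure set T -> \bar R}) (nu : set T -> \bar R)
    (p : T -> R) : Prop :=
  [/\ measurable_fun setT p, (forall x, 0 <= p x) &
      forall A, measurable A -> nu A = (\int[mu]_(x in A) (p x)%:E)%E].

End densities.

Section information.
Context d dX dU (T : measurableType d) (TX : measurableType dX)
  (TU : measurableType dU) (R : realType).
Variables (P : probability T R) (mu : {measure set TX -> \bar R}).

(** [p u x] is the conditional density at [x] of [X] given [U = u]. *)
Definition is_cond_density (X : T -> TX) (U : T -> TU) (p : TU -> TX -> R) : Prop :=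
  [/\ measurable_fun setT (fun z : TU * TX => p z.1 z.2),
      (forall u x, 0 <= p u x) &
      forall A B, measurable A -> measurable B ->
        P ((X @^-1` A) `&` (U @^-1` B)) =
        (\int[P]_(t in U @^-1` B) \int[mu]_(x in A) (p (U t) x)%:E)%E].

(** The entropies are extended reals. The convention [ln 0 = 0] is harmless, as
    a density almost surely does not vanish at its random variable. *)
Definition entropy (X : T -> TX) (p : TX -> R) : \bar R :=
  'E_P[fun t => - ln (p (X t))].

Definition cond_entropy (X : T -> TX) (U : T -> TU) (p : TU -> TX -> R) : \bar R :=
  'E_P[fun t => - ln (p (U t) (X t))].

End information.

Section norms.
Variable R : realType.

(** The library norm on matrices is the max norm. *)
Definition enorm m n (M : 'M[R]_(m, n)) : R :=
  Num.sqrt (\sum_i \sum_j M i j ^+ 2).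

Variables (m n m' n' : nat).
Implicit Types g : 'M[R]_(m, n) -> 'M[R]_(m', n').

Definition sup_bounded g := has_ubound [set enorm (g Y) | Y in setT].

Definition sup_norm g : R := sup [set enorm (g Y) | Y in setT].

Definition sup_dist (A : set ('M[R]_(m, n) -> 'M[R]_(m', n'))) g : R :=
  inf [set sup_norm (psi \- g) | psi in A].

End norms.

(** The data of the control problem: horizon [N], state in R^n, output in R^m,
    control in R^r, noises in R^nw and R^nv. The random variables [x0], [w k]
    and [v k] live on the probability space [(T, P)]. Stacked vectors such as
    X, Y and U are matrices whose [k]-th row is the value at time [k]. *)
Record control_problem (R : realType) d (T : measurableType d)
    (N n m r nw nv : nat) := ControlProblem {
  prob : probability T R ;
  Uad : set 'rV[R]_r ;
  dyn : 'rV[R]_n * 'rV[R]_r * 'rV[R]_nw -> 'rV[R]_n ;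
  obs : 'rV[R]_n * 'rV[R]_nv -> 'rV[R]_m ;
  loss : 'rV[R]_n -> R ;
  x0 : {RV prob >-> 'rV[R]_n} ;
  w : nat -> {RV prob >-> 'rV[R]_nw} ;
  v : nat -> {RV prob >-> 'rV[R]_nv} ;
  p0 : 'rV[R]_n -> R ;
  pw : 'rV[R]_nw -> R ;
  pv : 'rV[R]_nv -> R }.

Section control_problem_theory.
Context (R : realType) d (T : measurableType d) (N n m r nw nv : nat).
Variable S : control_problem R T N n m r nw nv.
Let P := prob S.

(** Subfamilies are covered by taking some of the sets to be full. *)
Definition noise_independent : Prop :=
  forall (k : nat) (A : set 'rV[R]_n) (B : nat -> set 'rV[R]_nw)
      (C : nat -> set 'rV[R]_nv),
    measurable A -> (forall i, measurable (B i)) ->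
    (forall i, measurable (C i)) ->
    P ((x0 S @^-1` A) `&`
       (\bigcap_(i in `I_k.+1) ((w S i @^-1` B i) `&` (v S i @^-1` C i)))) =
    (P (x0 S @^-1` A) *
     (\prod_(i < k.+1) P (w S i @^-1` B i)) *
     (\prod_(i < k.+1) P (v S i @^-1` C i)))%E.

Definition control_box (umin umax : 'rV[R]_r) : set 'rV[R]_r :=
  [set u | forall j, umin 0 j <= u 0 j <= umax 0 j].

Record standing_assumptions : Prop := {
  horizon_gt0 : (0 < N)%N ;
  Uad_shape : Uad S = setT \/ exists umin umax, Uad S = control_box umin umax ;
  dyn_C2 : Ck 2 (dyn S) ;
  obs_C2 : Ck 2 (obs S) ;
  loss_C2 : Ck 2 (loss S : 'rV[R]_n -> R^o) ;
  loss_measurable : measurable_fun setT (loss S) ;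
  x0_density : is_density (@lebesgue_mx R 1 n) (distribution P (x0 S)) (p0 S) ;
  w_density : forall k,
    is_density (@lebesgue_mx R 1 nw) (distribution P (w S k)) (pw S) ;
  v_density : forall k,
    is_density (@lebesgue_mx R 1 nv) (distribution P (v S k)) (pv S) ;
  independence : noise_independent }.

Definition strategy := 'M[R]_(N, m) -> 'M[R]_(N, r).

(** [past k Y] is Y_k = col(y_0, ..., y_k). *)
Definition past (k : 'I_N) (Y : 'M[R]_(N, m)) : 'M[R]_(k.+1, m) :=
  rowsub (widen_ord (ltn_ord k)) Y.

(** Boundedness is automatic when [Uad] is a box; when it is the whole space,
    it is what makes the strategies elements of the Banach space of bounded
    maps. *)
Definition Sad : set strategy := [set phi |
  sup_bounded phi /\
  exists phi_ : forall k : 'I_N, 'M[R]_(k.+1, m) -> 'rV[R]_r,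
    [/\ forall k, measurable_fun setT (phi_ k),
        forall k Yk, Uad S (phi_ k Yk) &
        forall Y k, row k (phi Y) = phi_ k (past k Y)]].

Definition row_at (U : 'M[R]_(N, r)) (k : nat) : 'rV[R]_r :=
  if insub k is Some i then row i U else 0.

Definition set_row (Y : 'M[R]_(N, m)) (k : nat) (y : 'rV[R]_m) : 'M[R]_(N, m) :=
  \matrix_(i, j) if val i == k then y 0 j else Y i j.

(** [closed_loop phi t k] is the pair of the outputs y_0, ..., y_(k-1), padded
    with null rows, and of the state x_k. At time [k] the control is read off
    [phi] at y_0, ..., y_k padded with null rows; for [phi] in [Sad] the
    padding is immaterial. *)
Fixpoint closed_loop (phi : strategy) (t : T) (k : nat)
    : 'M[R]_(N, m) * 'rV[R]_n :=
  if k is k'.+1 then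
    let: (Y, x) := closed_loop phi t k' in
    let Y' := set_row Y k' (obs S (x, v S k' t)) in
    (Y', dyn S (x, row_at (phi Y') k', w S k' t))
  else (0, x0 S t).

Definition state phi k t : 'rV[R]_n := (closed_loop phi t k).2.

Definition X_ phi t : 'M[R]_(N, n) := \matrix_(k < N) state phi k t.

Definition Y_ phi t : 'M[R]_(N, m) := (closed_loop phi t N).1.

Definition U_ phi t : 'M[R]_(N, r) := phi (Y_ phi t).

Lemma row_closed_loop phi t (i : 'I_N) k : (i < k)%N ->
  row i (closed_loop phi t k).1 = obs S (state phi i t, v S i t).
Proof.
elim: k => // k IH; rewrite ltnS => ik.
rewrite -[closed_loop phi t k.+1]/(let: (Y, x) := closed_loop phi t k in _).
move: IH; rewrite /state; case E : (closed_loop phi t k) => [Y x] /= IH.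
apply/rowP => j; rewrite !mxE; case: eqVneq => [ek|nk].
  by rewrite ek E.
by move: ik; rewrite leq_eqVlt (negbTE nk) => /IH /rowP /(_ j); rewrite mxE.
Qed.

Lemma closed_loop_obs phi t (k : 'I_N) :
  row k (Y_ phi t) = obs S (state phi k t, v S k t).
Proof. exact: row_closed_loop. Qed.

Lemma closed_loop_dyn phi t (k : 'I_N) : Sad phi ->
  state phi k.+1 t = dyn S (state phi k t, row k (U_ phi t), w S k t).
Proof.
move=> [_ [phi_ [_ _ phiE]]].
have past_k : past k (closed_loop phi t k.+1).1 = past k (Y_ phi t).
  apply/row_matrixP => i; rewrite !row_rowsub row_closed_loop ?closed_loop_obs//=.
rewrite /U_ phiE -past_k /state.
rewrite -[closed_loop phi t k.+1]/(let: (Y, x) := closed_loop phi t k in _).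
case E : (closed_loop phi t k) => [Y x] /=.
by rewrite -phiE /row_at; case: insubP => [i _ /val_inj ->|]//; rewrite ltn_ord.
Qed.

(** J is -oo when the integral of the positive part and that of the negative part
    are both infinite; J phi is finite exactly when the loss is integrable. *)
Definition J phi : \bar R := 'E_P[fun t => loss S (state phi N t)].

(** [pX phi] and [pXU phi] are versions of p(X|phi) and p(X|U,phi); the entropies
    do not depend on the choice of the versions. *)
Definition state_densities (pX : strategy -> 'M[R]_(N, n) -> R)
    (pXU : strategy -> 'M[R]_(N, r) -> 'M[R]_(N, n) -> R) : Prop :=
  forall phi, Sad phi ->
    is_density (@lebesgue_mx R N n) (pushforward P (X_ phi)) (pX phi) /\
    is_cond_density P (@lebesgue_mx R N n) (X_ phi) (U_ phi) (pXU phi).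

Variables (pX : strategy -> 'M[R]_(N, n) -> R)
          (pXU : strategy -> 'M[R]_(N, r) -> 'M[R]_(N, n) -> R).

(** For extended reals +oo - +oo = -oo, so a bound 0 <= info phi excludes the
    ill-defined differences. *)
Definition info phi : \bar R :=
  (entropy P (X_ phi) (pX phi) - cond_entropy P (X_ phi) (U_ phi) (pXU phi))%E.

Definition Omega (s : R) : set strategy :=
  [set phi | Sad phi /\ (info phi <= s%:E)%E].

Definition Jo : \bar R := ereal_inf [set J phi | phi in Omega 0].

End control_problem_theory.

(* Main.v *)
Require Import Defs.
From mathcomp Require Import all_boot all_order all_algebra.
From mathcomp Require Import all_classical all_reals all_analysis.
Import Order.TTheory GRing.Theory Num.Theory.
Import numFieldNormedType.Exports.
Local Open Scope classical_set_scope.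
Local Open Scope ring_scope.

(** Since [J] is Lipschitz, [Jo - J phi <= L_J * |psi - phi|] for every [psi] in
    [Omega 0]. Taking the infimum over [psi] bounds the gap by [L_J] times the
    distance from [phi] to [Omega 0], itself at most [info phi / L_I]; hence
    [q = L_J / L_I]. *)

Theorem theorem1 (R : realType) (d : measure_display) (T : measurableType d)
    (N n m r nw nv : nat) (S : control_problem R T N n m r nw nv)
    (pX : strategy R N m r -> 'M[R]_(N, n) -> R)
    (pXU : strategy R N m r -> 'M[R]_(N, r) -> 'M[R]_(N, n) -> R)
    (hS : standing_assumptions S)
    (hp : state_densities S pX pXU)
    (hmin : exists2 phi, Sad S phi & J S phi = ereal_inf (J S @` Sad S))
    (hOmega : forall s : R, 0 <= s -> exists2 phi, Omega S pX pXU s phi &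
       J S phi = ereal_inf (J S @` Omega S pX pXU s))
    (L_I L_J : R) (L_I_gt0 : 0 < L_I) (L_J_gt0 : 0 < L_J)
    (hJ : forall phi phi1, Sad S phi -> Sad S phi1 ->
       (`|J S phi - J S phi1| <= (L_J * sup_norm (phi1 \- phi))%:E)%E)
    (hI : forall phi, Sad S phi ->
       ((L_I * sup_dist (Omega S pX pXU 0) phi)%:E <= info S pX pXU phi)%E) :
  exists2 q : R, 0 < q & forall phi, Sad S phi ->
    (Jo S pX pXU - J S phi <= q%:E * info S pX pXU phi)%E.
Proof.
(* With [phi1 = phi], [hJ] forces [J phi] to be finite, as [|oo - oo| = oo]. *)
have Jfin phi : Sad S phi -> J S phi \is a fin_num.
  by move=> Sphi; have := hJ phi phi Sphi Sphi; case: (J S phi).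
(* A minimiser over [Omega 0] makes [Jo] finite and supplies the non-emptiness that the bound on the
   real [inf] requires. *)
have [psi0 Opsi0 Jpsi0] := hOmega 0 (lexx 0).
have JoE : Jo S pX pXU = J S psi0 by rewrite Jpsi0.
exists (L_J / L_I) => [|phi Sphi]; first exact: divr_gt0.
have Jphi := Jfin _ Sphi; have Jo_fin := Jfin _ Opsi0.1.
have le_dist : (fine (J S psi0) - fine (J S phi)) / L_J <=
    sup_dist (Omega S pX pXU 0) phi.
  apply: lb_le_inf; first by exists (sup_norm (psi0 \- phi)), psi0.
  move=> _ [psi Opsi <-]; rewrite ler_pdivrMr// mulrC -lee_fin EFinB !fineK//.
  apply: le_trans (hJ phi psi Sphi Opsi.1).
  have Jpsi := Jfin _ Opsi.1.
  (* As [J psi] is finite, the difference can be reversed inside the absolute value; minimality of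
     [psi0] then concludes. *)
  rewrite -abseN fin_num_oppeB// [in leRHS]addeC.
  apply: le_trans (lee_abs _); apply: leeB => //.
  by rewrite Jpsi0; apply: ereal_inf_lbound; exists psi.
(* [info phi] may be [+oo], so [hI] is scaled in the extended reals; the other inequality is between
   reals, and [L_I] cancels there. *)
apply: (@le_trans _ _ ((L_J / L_I)%:E *
    (L_I * sup_dist (Omega S pX pXU 0) phi)%:E)%E); last first.
  by rewrite lee_pmul2l ?lte_fin ?divr_gt0//; exact: hI.
rewrite JoE -(fineK Jphi) -(fineK Jo_fin) -EFinB -EFinM lee_fin.
by rewrite mulrA divfK ?gt_eqF// mulrC -ler_pdivrMr.
Qed.
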